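(* Let $A\in\mathbb{H}^{m\times n}$, $B\in\mathbb{H}^{m\times p_1}$, $C\in\mathbb{H}^{m\times p_2}$, $D\in\mathbb{H}^{q_1\times n}$, $E\in\mathbb{H}^{q_2\times n}$ be given, and let $p(X,Y)=A-BXD-CYE$, where $X\in\mathbb{H}^{p_1\times q_1}$ and $Y\in\mathbb{H}^{p_2\times q_2}$ are variable. Then $$\max_{X,Y} r[p(X,Y)]=\min\left\{r\begin{bmatrix}A\\ D\\ E\end{bmatrix},\ r\begin{bmatrix}A&B&C\end{bmatrix},\ r\begin{bmatrix}A&B\\ E&0\end{bmatrix},\ r\begin{bmatrix}A&C\\ D&0\end{bmatrix}\right\},$$ $$\min_{X,Y} r[p(X,Y)]=r\begin{bmatrix}A\\ D\\ E\end{bmatrix}+r\begin{bmatrix}A&B&C\end{bmatrix}+\max\{s_1,s_2\},$$ where $$s_1=r\begin{bmatrix}A&B\\ E&0\end{bmatrix}-r\begin{bmatrix}A&B&C\\ E&0&0\end{bmatrix}-r\begin{bmatrix}A&B\\ D&0\\ E&0\end{bmatrix},\qquad s_2=r\begin{bmatrix}A&C\\ D&0\end{bmatrix}-r\begin{bmatrix}A&B&C\\ D&0&0\end{bmatrix}-r\begin{bmatrix}A&C\\ D&0\\ E&0\end{bmatrix}.$$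
   Context: $\mathbb{H}$ is the real quaternion algebra and $\mathbb{H}^{m\times n}$ is the set of $m\times n$ matrices over $\mathbb{H}$. The rank $r(M)$ of a quaternion matrix $M$ is the dimension of its column right space (equivalently, of its row left space). The maximum and minimum are over all quaternion matrices $X,Y$ of the indicated sizes. *)

(* Defs.v *)
From HB Require Import structures.
From mathcomp Require Import all_boot all_order all_algebra.
From mathcomp Require Import ring lra.
From mathcomp Require Import boolp classical_sets reals.

Set Implicit Arguments.
Unset Strict Implicit.
Unset Printing Implicit Defensive.

Import Order.TTheory GRing.Theory Num.Theory.

Local Open Scope ring_scope.

(* [Quat a b c d] stands for a + b i + c j + d k, with
   i^2 = j^2 = k^2 = ijk = -1. *)
Record quat (R : realType) := Quat { q_re : R; q_i : R; q_j : R; q_k : R }.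

Section QuatRing.
Variable R : realType.
Local Notation H := (quat R).
Implicit Types x y z : H.

Definition quat_to_prod x : R * R * R * R := (q_re x, q_i x, q_j x, q_k x).
Definition quat_of_prod (t : R * R * R * R) : H :=
  let: (a, b, c, d) := t in Quat a b c d.

Lemma quat_to_prodK : cancel quat_to_prod quat_of_prod.
Proof. by case. Qed.

HB.instance Definition _ := Choice.copy H (can_type quat_to_prodK).

Definition quat0 : H := Quat 0 0 0 0.
Definition quat1 : H := Quat 1 0 0 0.
Definition quat_opp x : H := Quat (- q_re x) (- q_i x) (- q_j x) (- q_k x).
Definition quat_add x y : H :=
  Quat (q_re x + q_re y) (q_i x + q_i y) (q_j x + q_j y) (q_k x + q_k y).
Definition quat_mul x y : H :=
  let: Quat a b c d := x in
  let: Quat a' b' c' d' := y in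
  Quat (a * a' - b * b' - c * c' - d * d')
       (a * b' + b * a' + c * d' - d * c')
       (a * c' - b * d' + c * a' + d * b')
       (a * d' + b * c' - c * b' + d * a').

Lemma quat_addA : associative quat_add.
Proof. by move=> [? ? ? ?] [? ? ? ?] [? ? ? ?]; rewrite /quat_add /= !addrA. Qed.
Lemma quat_addC : commutative quat_add.
Proof.
move=> [a b c d] [a' b' c' d']; rewrite /quat_add /=.
by congr Quat; rewrite addrC.
Qed.
Lemma quat_add0 : left_id quat0 quat_add.
Proof. by move=> [? ? ? ?]; rewrite /quat_add /= !add0r. Qed.
Lemma quat_addN : left_inverse quat0 quat_opp quat_add.
Proof. by move=> [? ? ? ?]; rewrite /quat_add /= !addNr. Qed.

HB.instance Definition _ :=
  GRing.isZmodule.Build H quat_addA quat_addC quat_add0 quat_addN.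

Lemma quat_mulA : associative quat_mul.
Proof.
move=> [? ? ? ?] [? ? ? ?] [? ? ? ?]; rewrite /quat_mul /=.
by congr Quat; ring.
Qed.
Lemma quat_mul1l : left_id quat1 quat_mul.
Proof. by move=> [? ? ? ?]; rewrite /quat_mul /=; congr Quat; ring. Qed.
Lemma quat_mul1r : right_id quat1 quat_mul.
Proof. by move=> [? ? ? ?]; rewrite /quat_mul /=; congr Quat; ring. Qed.
Lemma quat_mulDl : left_distributive quat_mul quat_add.
Proof.
move=> [? ? ? ?] [? ? ? ?] [? ? ? ?]; rewrite /quat_mul /quat_add /=.
by congr Quat; ring.
Qed.
Lemma quat_mulDr : right_distributive quat_mul quat_add.
Proof.
move=> [? ? ? ?] [? ? ? ?] [? ? ? ?]; rewrite /quat_mul /quat_add /=.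
by congr Quat; ring.
Qed.
Lemma quat1_neq0 : quat1 != quat0.
Proof. by apply/eqP => -[/eqP]; rewrite oner_eq0. Qed.

HB.instance Definition _ := GRing.Zmodule_isNzRing.Build H
  quat_mulA quat_mul1l quat_mul1r quat_mulDl quat_mulDr quat1_neq0.

Definition quat_sqnorm x : R := q_re x ^+ 2 + q_i x ^+ 2 + q_j x ^+ 2 + q_k x ^+ 2.
Definition quat_inv x : H :=
  let s := quat_sqnorm x in
  Quat (q_re x / s) (- q_i x / s) (- q_j x / s) (- q_k x / s).

Lemma quat_sqnorm_eq0 x : (quat_sqnorm x == 0) = (x == 0).
Proof.
case: x => a b c d; rewrite /quat_sqnorm /=.
apply/eqP/eqP => [|[-> -> -> ->]]; last by rewrite expr0n /= !addr0.
move=> /eqP; rewrite !paddr_eq0 ?addr_ge0 ?sqr_ge0 // !sqrf_eq0.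
by case/andP => /andP[/andP[/eqP-> /eqP->] /eqP->] /eqP->.
Qed.

Lemma quat_mulVx x : x != 0 -> quat_inv x * x = 1.
Proof.
rewrite -quat_sqnorm_eq0; case: x => a b c d.
rewrite /quat_inv /quat_sqnorm /= => s0.
by congr Quat; rewrite /=; field.
Qed.
Lemma quat_mulxV x : x != 0 -> x * quat_inv x = 1.
Proof.
rewrite -quat_sqnorm_eq0; case: x => a b c d.
rewrite /quat_inv /quat_sqnorm /= => s0.
by congr Quat; rewrite /=; field.
Qed.
Lemma quat_unitP x y : y * x = 1 /\ x * y = 1 -> x != 0.
Proof. by case=> + _; apply: contra_eqN => /eqP->; rewrite mulr0 eq_sym oner_eq0. Qed.
Lemma quat_inv_out : {in [predC (fun x : H => x != 0)], quat_inv =1 id}.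
Proof.
move=> x; rewrite inE negbK => /eqP->.
by rewrite /quat_inv /= oppr0 !mul0r.
Qed.

HB.instance Definition _ := GRing.NzRing_hasMulInverse.Build H
  quat_mulVx quat_mulxV quat_unitP quat_inv_out.

Lemma quat_unitE x : (x \is a GRing.unit) = (x != 0).
Proof. by []. Qed.

End QuatRing.

Section Rank.
Variable R : realType.
Local Notation H := (quat R).

Definition right_colspace m n (M : 'M[H]_(m, n)) : set 'cV[H]_m :=
  [set v | exists x : 'cV[H]_n, v = M *m x].

(* [M *m x] is the combination of the columns of M with the entries of x as
   coefficients on the right: the scalars act on the right. *)
Definition right_free m k (U : 'M[H]_(m, k)) : Prop :=
  forall c : 'cV[H]_k, U *m c = 0 -> c = 0.

(* The columns of U form a basis of the right vector space S. *)
Definition right_basis m k (U : 'M[H]_(m, k)) (S : set 'cV[H]_m) : Prop :=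
  right_free U /\ right_colspace U = S.

(* MathComp's [\rank] needs commutative scalars. The default value 0 of [xget]
   is never used, and the size does not depend on the basis: see [qrank_basis]
   and [qrank_uniq]. *)
Definition qrank m n (M : 'M[H]_(m, n)) : nat :=
  xget 0%N [set k | exists U : 'M[H]_(m, k), right_basis U (right_colspace M)].

Lemma right_dependent l k (W : 'M[H]_(l, k)) :
  (l < k)%N -> ~ right_free W.
Proof.
suff: (l < k)%N -> exists2 c : 'cV[H]_k, c != 0 & W *m c = 0.
  by move=> + lk fW => /(_ lk) [c + /fW c0]; rewrite c0 eqxx.
elim: l k W => [|l IHl] [|k] // W.
  move=> _; exists (const_mx 1); last by apply/matrixP => -[].
  by apply/eqP => /matrixP/(_ 0 0)/eqP; rewrite !mxE oner_eq0.
move=> lk; have [[j Wj]|W0] := pselect (exists j, W 0 j != 0); last first.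
  have [c c0 Wc] := IHl _ (row' 0 W) (ltnW lk); exists c => //.
  apply/matrixP => i o; rewrite [RHS]mxE; case: (unliftP 0 i) => [i' ->|->].
    have /matrixP/(_ i' o) := Wc; rewrite !mxE => Vc0; rewrite -[RHS]Vc0.
    by apply: eq_bigr => t _; rewrite !mxE.
  rewrite mxE big1 // => t _; have [->|Wt] := eqVneq (W 0 t) 0.
    by rewrite mul0r.
  by case: W0; exists t.
pose a := W 0 j.
pose V : 'M[H]_(l, k) := \matrix_(i, t)
  (W (lift 0 i) (lift j t) - W (lift 0 i) j * a^-1 * W 0 (lift j t)).
have [c c0 Vc] := IHl _ V lk.
pose s := \sum_t W 0 (lift j t) * c t 0.
pose d : 'cV[H]_k.+1 :=
  \col_t (if unlift j t is Some t' then c t' 0 else - (a^-1 * s)).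
have dj o : d j o = - (a^-1 * s) by rewrite mxE unlift_none.
have dl t o : d (lift j t) o = c t 0 by rewrite mxE liftK.
exists d.
  apply: contra_neq c0 => d0; apply/matrixP => t o.
  by rewrite (ord1 o) -(dl t 0) d0 !mxE.
apply/matrixP => i o; rewrite !mxE (bigD1_ord j) //= dj.
under eq_bigr do rewrite dl.
case: (unliftP 0 i) => [i' ->|->].
  have /matrixP/(_ i' 0) := Vc; rewrite !mxE => Vc0; rewrite -[RHS]Vc0.
  rewrite mulrN mulrA /s mulr_sumr -sumrN -big_split /=.
  by apply: eq_bigr => t _; rewrite !mxE mulrBl !mulrA addrC.
by rewrite mulrN mulrA divrr ?mul1r ?addNr // quat_unitE.
Qed.

Lemma right_basis_leq m k l (U : 'M[H]_(m, k)) (V : 'M[H]_(m, l)) :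
    right_free U -> (right_colspace U `<=` right_colspace V)%classic ->
  (k <= l)%N.
Proof.
move=> fU sUV; rewrite leqNgt; apply/negP => lk.
have /choice[W WP] : forall j, exists w : 'cV[H]_l, col j U = V *m w.
  by move=> j; apply: sUV; exists (delta_mx j 0); rewrite colE.
pose X : 'M[H]_(l, k) := \matrix_(i, j) W j i 0.
have UE : U = V *m X.
  apply/matrixP => i j; have /matrixP/(_ i 0) := WP j; rewrite !mxE => ->.
  by apply: eq_bigr => t _; rewrite mxE.
apply: (right_dependent (W := X) lk) => c Xc; apply: fU.
by rewrite UE -mulmxA Xc mulmx0.
Qed.

Lemma right_basis_exists m n (M : 'M[H]_(m, n)) :
  exists k, exists U : 'M[H]_(m, k), right_basis U (right_colspace M).
Proof.
pose P k := `[< exists U : 'M[H]_(m, k),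
  right_free U /\ exists X, U = M *m X >].
have P0 : exists k, P k.
  exists 0%N; apply/asboolP; exists 0; split; last by exists 0; rewrite mulmx0.
  by move=> c _; rewrite [c]flatmx0.
have Pm k : P k -> (k <= m)%N.
  move=> /asboolP[U [fU _]]; rewrite leqNgt; apply/negP => mk.
  exact: (right_dependent mk fU).
case: (ex_maxnP P0 Pm) => k /asboolP[U [fU [X UE]]] kmax.
exists k, U; split=> //; apply/seteqP; split=> v [x ->].
  by exists (X *m x); rewrite UE mulmxA.
apply: contrapT => vU; suff /kmax : P (k + 1)%N by rewrite addn1 ltnn.
apply/asboolP; exists (row_mx U (M *m x)); split; last first.
  by exists (row_mx X x); rewrite mul_mx_row UE.
move=> c; rewrite -[c]vsubmxK; set c1 := usubmx c; set c2 := dsubmx c.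
rewrite mul_row_col => Uc.
have c2E : c2 = (c2 0 0)%:M by exact: mx11_scalar.
have [c20|c20] := eqVneq (c2 0 0) 0.
  have c2_0 : c2 = 0 by rewrite c2E c20; apply/matrixP => i j; rewrite !mxE mul0rn.
  by move: Uc; rewrite c2_0 mulmx0 addr0 => /fU->; rewrite col_mx0.
case: vU; exists (- (c1 *m ((c2 0 0)^-1)%:M)).
rewrite mulmxN mulmxA; move/eqP: Uc; rewrite addr_eq0 => /eqP->.
rewrite mulNmx opprK -[RHS]mulmxA {1}c2E -scalar_mxM divrr ?quat_unitE //.
by rewrite mulmx1.
Qed.

Lemma qrank_basis m n (M : 'M[H]_(m, n)) :
  exists U : 'M[H]_(m, qrank M), right_basis U (right_colspace M).
Proof. exact: (xgetPex 0%N (right_basis_exists M)). Qed.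

Lemma qrank_uniq m n k (M : 'M[H]_(m, n)) (U : 'M[H]_(m, k)) :
  right_basis U (right_colspace M) -> qrank M = k.
Proof.
move=> [fU UM]; have [V [fV VM]] := qrank_basis M.
by apply/eqP; rewrite eqn_leq (right_basis_leq fV (V := U)) ?VM ?UM //
  (right_basis_leq fU (V := V)) ?VM ?UM.
Qed.

End Rank.

Definition is_max d (T : porderType d) (S : set T) (x : T) : Prop :=
  S x /\ ubound S x.

Definition is_min d (T : porderType d) (S : set T) (x : T) : Prop :=
  S x /\ lbound S x.

(* Main.v *)
Require Import Defs.
From mathcomp Require Import all_boot all_order all_algebra.
From mathcomp Require Import boolp classical_sets reals.
From mathcomp Require Import zify.
Import Order.TTheory GRing.Theory Num.Theory.
Local Open Scope ring_scope.

(** The right-hand sides do not change when [A] is replaced by [P = p(X,Y)], so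
    one may start from a [P] of extremal rank.  Everything is then expressed by
    the pairing [<v P, P u> = v P u] between the row space and the column space
    of [P]: if [v P u = 1], then [P - P u v P] has smaller rank.  The rank of
    [[P, N], [L, 0]] exceeds [r[P, N] + r[P; L] - r(P)] by the rank of this
    pairing between the parts of [L] and [N] lying in the row and column space of
    [P]; this gives the lower bound for the minimum, and its failure to be attained
    gives, for each of [s1] and [s2], vectors with nonzero pairing.  In each of the
    resulting four cases subtracting at most three products [(B x) (y D)] or
    [(C x) (y E)] lowers the rank of [P].
    Likewise, when [r(P)] is smaller than the four ranks bounding the maximum, one
    or two such products raise it. *)

Section QuaternionRank.
Context {R : realType}.
Local Notation K := (quat R).

(** * Factorizations and elementary rank inequalities *)

Lemma colspace_factor {m n k} {M : 'M[K]_(m, n)} {U : 'M[K]_(m, k)} :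
  (right_colspace M `<=` right_colspace U)%classic -> exists X, M = U *m X.
Proof.
move=> sMU.
have /choice[W WP] : forall j, exists w : 'cV[K]_k, col j M = U *m w.
  by move=> j; apply: sMU; exists (delta_mx j 0); rewrite colE.
exists (\matrix_(i, j) W j i 0); apply/matrixP => i j.
have /matrixP/(_ i 0) := WP j; rewrite !mxE => ->.
by apply: eq_bigr => t _; rewrite mxE.
Qed.

Lemma colspace_mulmx {m n k} (U : 'M[K]_(m, k)) (X : 'M[K]_(k, n)) :
  (right_colspace (U *m X) `<=` right_colspace U)%classic.
Proof. by move=> _ [x ->]; exists (X *m x); rewrite mulmxA. Qed.

Lemma qrank_factor {m n} (M : 'M[K]_(m, n)) :
  exists (U : 'M[K]_(m, qrank M)) (V : 'M[K]_(qrank M, n)) (W : 'M[K]_(n, qrank M)),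
    [/\ M = U *m V, U = M *m W & right_free U].
Proof.
have [U [fU UM]] := qrank_basis M.
have [V ME] : exists V, M = U *m V by apply: colspace_factor; rewrite UM.
have [W UE] : exists W, U = M *m W by apply: colspace_factor; rewrite UM.
by exists U, V, W.
Qed.

Lemma qrank_le_inner {m n k} (U : 'M[K]_(m, k)) (V : 'M[K]_(k, n)) :
  (qrank (U *m V) <= k)%N.
Proof.
have [W [fW WE]] := qrank_basis (U *m V).
by apply: (right_basis_leq fW (V := U)); rewrite WE; exact: colspace_mulmx.
Qed.

Lemma qrank_ge_free {m n k} (M : 'M[K]_(m, n)) (W : 'M[K]_(n, k)) :
  right_free (M *m W) -> (k <= qrank M)%N.
Proof.
have [U [V [_ [ME _ _]]]] := qrank_factor M; rewrite {1}ME -mulmxA => fMW.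
exact: (right_basis_leq fMW (colspace_mulmx _ _)).
Qed.

Lemma qrank_mulmxl {m n k} (X : 'M[K]_(k, m)) (M : 'M[K]_(m, n)) :
  (qrank (X *m M) <= qrank M)%N.
Proof.
have [U [V [_ [ME _ _]]]] := qrank_factor M.
by rewrite {1}ME mulmxA qrank_le_inner.
Qed.

Lemma qrank_mulmxr {m n k} (M : 'M[K]_(m, n)) (Y : 'M[K]_(n, k)) :
  (qrank (M *m Y) <= qrank M)%N.
Proof.
have [U [V [_ [ME _ _]]]] := qrank_factor M.
by rewrite {1}ME -mulmxA qrank_le_inner.
Qed.

Lemma qrankD {m n} (M N : 'M[K]_(m, n)) :
  (qrank (M + N) <= qrank M + qrank N)%N.
Proof.
have [U [V [_ [ME _ _]]]] := qrank_factor M.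
have [U' [V' [_ [NE _ _]]]] := qrank_factor N.
by rewrite {1}ME {1}NE -mul_row_col qrank_le_inner.
Qed.

Lemma qrankN {m n} (M : 'M[K]_(m, n)) : qrank (- M) = qrank M.
Proof.
have le N : (qrank (- N : 'M[K]_(m, n)) <= qrank N)%N.
  by rewrite -[- N]mul1mx mulmxN -mulNmx qrank_mulmxl.
by apply/eqP; rewrite eqn_leq le -{1}[M]opprK le.
Qed.

Lemma qrank0 {m n} : qrank (0 : 'M[K]_(m, n)) = 0%N.
Proof.
by apply/eqP; rewrite -leqn0 -(mul0mx _ (0 : 'M_(0, n))) qrank_le_inner.
Qed.

(** The difference [Q] satisfies [v Q = 0] while [v P u = 1], so [P u] lies outside the column space
    of [Q]. Both lie in the column space of [P], so a column basis [U] of [Q] extended by [P u]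
    consists of independent columns there. *)
Lemma qrank_deflate {m n} {P : 'M[K]_(m, n)} {u : 'cV[K]_n} {v : 'rV[K]_m} :
  v *m P *m u = 1%:M -> (qrank (P - P *m u *m v *m P) < qrank P)%N.
Proof.
move=> vPu; set Q := P - _.
have [U [V [W [_ UE fU]]]] := qrank_factor Q.
have vU : v *m U = 0.
  by rewrite UE mulmxA /Q mulmxBr !mulmxA vPu mul1mx subrr mul0mx.
suff /qrank_ge_free : right_free (P *m row_mx ((1%:M - u *m v *m P) *m W) u).
  by rewrite addn1.
have -> : P *m row_mx ((1%:M - u *m v *m P) *m W) u = row_mx U (P *m u).
  by rewrite mul_mx_row mulmxA mulmxBr mulmx1 !mulmxA -/Q -UE.
move=> c; rewrite -[c]vsubmxK mul_row_col => Uc.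
have c2 : dsubmx c = 0.
  have := congr1 (mulmx v) Uc.
  by rewrite mulmxDr !mulmxA vU vPu mul0mx add0r mul1mx mulmx0.
by move: Uc; rewrite c2 mulmx0 addr0 => /fU ->; rewrite col_mx0.
Qed.

(** * Nonzero pairings and inner inverses *)

Lemma scale_to_1 (a : 'M[K]_1) :
  a != 0 -> exists2 b : 'M[K]_1, a *m b = 1%:M & b *m a = 1%:M.
Proof.
move=> a0; have aE : a = (a 0 0)%:M := mx11_scalar a.
have ua : a 0 0 \is a GRing.unit.
  rewrite quat_unitE; apply: contra_neq a0 => a0.
  by rewrite aE a0; apply/matrixP => i j; rewrite !mxE mul0rn.
move: (a 0 0) aE ua => c -> uc.
by exists c^-1%:M; rewrite -scalar_mxM ?divrr ?mulVr.
Qed.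

Lemma exists_pairing_1 {m n} (M : 'M[K]_(m, n)) :
  M != 0 -> exists (v : 'rV_m) (u : 'cV_n), v *m M *m u = 1%:M.
Proof.
move=> M0; have [[i [j Mij]]|Z] := pselect (exists i j, M i j != 0); last first.
  case/eqP: M0; apply/matrixP => i j; rewrite mxE.
  by apply/eqP/negPn/negP => Mij; apply: Z; exists i, j.
have [|b ab _] := @scale_to_1 (delta_mx 0 i *m M *m delta_mx j 0).
  apply: contra_neq Mij => /matrixP/(_ 0 0).
  by rewrite -rowE -colE !mxE.
by exists (delta_mx 0 i), (delta_mx j 0 *m b); rewrite mulmxA.
Qed.

(** Induction on the rank, deflating [M] at a pair with [v M u = 1]. *)
Lemma ginv_exists {m n} (M : 'M[K]_(m, n)) :
  exists G : 'M[K]_(n, m), M *m G *m M = M.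
Proof.
have [k] := ubnP (qrank M); elim: k M => // k IH M.
rewrite ltnS => Mk; have [->|M0] := eqVneq M 0.
  by exists 0; rewrite mulmx0.
have [v [u vMu]] := exists_pairing_1 M M0.
have [G GE] := IH _ (leq_trans (qrank_deflate vMu) Mk).
(* With [Q = M - M u v M] the deflated matrix, [Q = M (1 - u v M) = (1 - M u v) M]. Hence the second
   summand contributes [Q G Q = Q], and [u v] restores the missing [M u v M]. *)
exists (u *m v + (1%:M - u *m v *m M) *m G *m (1%:M - M *m u *m v)).
rewrite mulmxDr mulmxDl.
have -> : M *m ((1%:M - u *m v *m M) *m G *m (1%:M - M *m u *m v)) *m M
          = M - M *m u *m v *m M.
  rewrite -[RHS]GE -!mulmxA [in RHS]mulmxBl [in RHS]mulmxBr.
  by rewrite !mulmxBl !mulmxBr !mul1mx !mulmxA.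
by rewrite !mulmxA addrC subrK.
Qed.

Definition ginv {m n} (M : 'M[K]_(m, n)) : 'M[K]_(n, m) :=
  projT1 (cid (ginv_exists M)).

Lemma mul_ginv {m n} (M : 'M[K]_(m, n)) : M *m ginv M *m M = M.
Proof. exact: projT2 (cid (ginv_exists M)). Qed.

(** * Ranks of bordered matrices *)

(** Column operations replace [N] by [N1 = N - M G N]. As [M G] fixes the columns of [M] and kills
    those of [N1], the two column spaces meet only in 0 and their bases can be concatenated. *)
Lemma qrank_row_mx {m n k} {M : 'M[K]_(m, n)} (N : 'M[K]_(m, k)) {G} :
  M *m G *m M = M ->
  qrank (row_mx M N) = (qrank M + qrank (N - M *m G *m N))%N.
Proof.
move=> MGM; set N1 := N - _.
have e1 : row_mx M N = row_mx M N1 *m block_mx 1%:M (G *m N) 0 1%:M.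
  by rewrite mul_row_block !mulmx1 mulmx0 addr0 mulmxA addrC subrK.
have e2 : row_mx M N1 = row_mx M N *m block_mx 1%:M (- (G *m N)) 0 1%:M.
  by rewrite mul_row_block !mulmx1 mulmx0 addr0 mulmxN mulmxA addrC.
have -> : qrank (row_mx M N) = qrank (row_mx M N1).
  by apply/eqP; rewrite eqn_leq {1}e1 qrank_mulmxr e2 qrank_mulmxr.
have [U [V [W [ME UE fU]]]] := qrank_factor M.
have [U' [V' [W' [NE UE' fU']]]] := qrank_factor N1.
apply/eqP; rewrite eqn_leq; apply/andP; split.
  rewrite {1}ME {1}NE.
  have -> : row_mx (U *m V) (U' *m V') = row_mx U U' *m block_mx V 0 0 V'.
    by rewrite mul_row_block !mulmx0 addr0 add0r.
  exact: qrank_le_inner.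
apply: (qrank_ge_free _ (block_mx W 0 0 W')).
rewrite mul_row_block !mulmx0 addr0 add0r -UE -UE' => c.
rewrite -[c]vsubmxK mul_row_col => Uc.
have Uc1 : U *m usubmx c = 0.
  have := congr1 (mulmx (M *m G)) Uc.
  rewrite mulmxDr mulmx0 {1}UE UE' /N1 !mulmxA MGM.
  by rewrite mulmxBr !mulmxA MGM subrr !mul0mx addr0 -UE.
move: Uc; rewrite Uc1 add0r => /fU' ->.
by rewrite (fU _ Uc1) col_mx0.
Qed.

(** An arbitrary inner inverse [G] is allowed because [qrank_block_mx] supplies an explicit one for
    a row of two blocks. *)
Lemma qrank_col_mx {m n k} {M : 'M[K]_(m, n)} (L : 'M[K]_(k, n)) {G} :
  M *m G *m M = M ->
  qrank (col_mx M L) = (qrank M + qrank (L - L *m G *m M))%N.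
Proof.
move=> MGM; set L1 := L - _.
have e1 : col_mx M L = block_mx 1%:M 0 (L *m G) 1%:M *m col_mx M L1.
  by rewrite mul_block_col !mul1mx mul0mx addr0 addrC subrK.
have e2 : col_mx M L1 = block_mx 1%:M 0 (- (L *m G)) 1%:M *m col_mx M L.
  by rewrite mul_block_col !mul1mx mul0mx addr0 mulNmx addrC.
have -> : qrank (col_mx M L) = qrank (col_mx M L1).
  by apply/eqP; rewrite eqn_leq {1}e1 qrank_mulmxl e2 qrank_mulmxl.
have [U [V [W [ME UE fU]]]] := qrank_factor M.
have [U' [V' [W' [LE UE' fU']]]] := qrank_factor L1.
apply/eqP; rewrite eqn_leq; apply/andP; split.
  rewrite {1}ME {1}LE.
  have -> : col_mx (U *m V) (U' *m V') = block_mx U 0 0 U' *m col_mx V V'.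
    by rewrite mul_block_col !mul0mx addr0 add0r.
  exact: qrank_le_inner.
(* [Q] acts as the identity on the right of [M] and kills [L1], so [Q] and [1 - Q] separate the
   contributions of [M] and [L1]. *)
pose Q := G *m M.
have MQ : M *m Q = M by rewrite /Q mulmxA.
have LQ : L1 *m Q = 0.
  by rewrite /L1 mulmxBl -(mulmxA (L *m G)) MQ mulmxA subrr.
clearbody Q.
apply: (qrank_ge_free _ (row_mx (Q *m W) ((1%:M - Q) *m W'))).
have -> : col_mx M L1 *m row_mx (Q *m W) ((1%:M - Q) *m W') = block_mx U 0 0 U'.
  rewrite mul_col_row  !mulmxA MQ LQ !mulmxBr MQ LQ !mulmx1 subrr subr0.
  by rewrite !mul0mx -UE -UE'.
move=> c; rewrite -[c]vsubmxK mul_block_col !mul0mx addr0 add0r.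
rewrite -{1}col_mx0 => /eq_col_mx[/fU -> /fU' ->]; exact: col_mx0.
Qed.

(** An idempotent whose kernel is the column space of [M]: [coker_proj P *m N] represents the
    columns of [N] modulo those of [P]. In the same way [L *m ker_proj P] represents the rows of [L]
    modulo those of [P]. *)
Definition coker_proj {m n} (M : 'M[K]_(m, n)) : 'M[K]_m := 1%:M - M *m ginv M.
Definition ker_proj {m n} (M : 'M[K]_(m, n)) : 'M[K]_n := 1%:M - ginv M *m M.

Lemma mul_coker_proj {m n} (M : 'M[K]_(m, n)) : coker_proj M *m M = 0.
Proof. by rewrite mulmxBl mul1mx mul_ginv subrr. Qed.

Lemma mul_ker_proj {m n} (M : 'M[K]_(m, n)) : M *m ker_proj M = 0.
Proof. by rewrite mulmxBr mulmx1 mulmxA mul_ginv subrr. Qed.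

Lemma ker_proj_id {m n k} {M : 'M[K]_(m, n)} {X : 'M[K]_(n, k)} :
  M *m X = 0 -> ker_proj M *m X = X.
Proof. by move=> MX; rewrite mulmxBl mul1mx -mulmxA MX mulmx0 subr0. Qed.

(* The pairing between the rows of [L] lying in the row space of [P] and the
   columns of [N] lying in the column space of [P]: the two projectors select the
   combinations of rows of [L], resp. of columns of [N], with this property. *)
Definition residual_pairing {m n k l} (P : 'M[K]_(m, n)) (L : 'M[K]_(l, n))
    (N : 'M[K]_(m, k)) : 'M[K]_(l, k) :=
  coker_proj (L *m ker_proj P) *m L *m ginv P *m N *m ker_proj (coker_proj P *m N).

Lemma qrank_row_coker {m n k} (P : 'M[K]_(m, n)) (N : 'M[K]_(m, k)) :
  qrank (row_mx P N) = (qrank P + qrank (coker_proj P *m N))%N.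
Proof. by rewrite (qrank_row_mx _ (mul_ginv P)) mulmxBl mul1mx. Qed.

Lemma qrank_col_ker {m n l} (P : 'M[K]_(m, n)) (L : 'M[K]_(l, n)) :
  qrank (col_mx P L) = (qrank P + qrank (L *m ker_proj P))%N.
Proof. by rewrite (qrank_col_mx _ (mul_ginv P)) mulmxBr mulmx1 mulmxA. Qed.

(** Reducing [[L, 0]] modulo the rows of [[P, N]] leaves [L *m ker_proj P] next to a block which,
    modulo the columns of [L *m ker_proj P], is minus the residual pairing. *)
Lemma qrank_block_mx {m n k l} (P : 'M[K]_(m, n)) (L : 'M[K]_(l, n))
    (N : 'M[K]_(m, k)) :
  qrank (block_mx P N L 0) =
  (qrank (row_mx P N) + qrank (L *m ker_proj P) + qrank (residual_pairing P L N))%N.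
Proof.
rewrite block_mxEv; set G := ginv P; set Q := coker_proj P; set N1 := Q *m N.
set G1 := ginv N1.
(* An inner inverse of [[P, N]]: [G1 Q] gives coordinates along [N] modulo the columns of [P], and
   [G] acts on what is left after subtracting that part of [N]. *)
pose W := col_mx (G - G *m N *m G1 *m Q) (G1 *m Q).
have QP : Q *m P = 0 := mul_coker_proj P.
have WP : W *m P = col_mx (G *m P) 0.
  by rewrite mul_col_mx mulmxBl -!mulmxA QP !mulmx0 subr0.
have WN : W *m N = col_mx (G *m N *m ker_proj N1) (G1 *m N1).
  by rewrite mul_col_mx mulmxBl /ker_proj (mulmxBr (G *m N)) mulmx1 /N1 !mulmxA.
have MWM : row_mx P N *m W *m row_mx P N = row_mx P N.
  rewrite -mulmxA !mul_mx_row WP WN !mul_row_col mulmx0 addr0 mulmxA mul_ginv.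
  have -> : N *m (G1 *m N1) = P *m G *m N *m (G1 *m N1) + N1 *m (G1 *m N1).
    by rewrite -mulmxDl {2}/N1 [Q *m N]mulmxBl mul1mx addrC subrK.
  have -> : P *m (G *m N *m ker_proj N1)
            = P *m G *m N - P *m G *m N *m (G1 *m N1).
    by rewrite [G *m N *m _]mulmxBr mulmx1 mulmxBr !mulmxA.
  rewrite addrA subrK [N1 *m _]mulmxA mul_ginv /N1 [Q *m N]mulmxBl mul1mx.
  by rewrite addrC subrK.
rewrite (qrank_col_mx _ MWM) -addnA; congr addn.
have -> : row_mx L 0 - row_mx L 0 *m W *m row_mx P N
          = row_mx (L *m ker_proj P) (- (L *m G *m N *m ker_proj N1)).
  rewrite -mulmxA !mul_mx_row WP WN !mul_row_col !mul0mx !addr0.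
  by rewrite opp_row_mx add_row_mx sub0r [L *m ker_proj P]mulmxBr mulmx1 !mulmxA.
by rewrite qrank_row_coker mulmxN qrankN !mulmxA.
Qed.

(** If [N J x] lies in the column space of [P], then [J x] is already among the combinations
    selected for [N]. So the pairing for [N J] factors through the one for [N]. *)
Lemma qrank_residual_le {m n k k' l} (P : 'M[K]_(m, n)) (L : 'M[K]_(l, n))
    (N : 'M[K]_(m, k)) (J : 'M[K]_(k, k')) :
  (qrank (residual_pairing P L (N *m J)) <= qrank (residual_pairing P L N))%N.
Proof.
have -> : residual_pairing P L (N *m J)
    = residual_pairing P L N *m (J *m ker_proj (coker_proj P *m (N *m J))).
  rewrite /residual_pairing -[in RHS](mulmxA _ (ker_proj _)) ker_proj_id.
    by rewrite !mulmxA.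
  by rewrite (mulmxA _ J) -(mulmxA _ N J) mul_ker_proj.
exact: qrank_mulmxr.
Qed.

(** The outer projectors, absorbed into [x] and [y], are what puts [N x] in the column space and
    [y L] in the row space of [P]. *)
Lemma residual_pairing_witness {m n k l} {P : 'M[K]_(m, n)} {L : 'M[K]_(l, n)}
    {N : 'M[K]_(m, k)} : residual_pairing P L N != 0 ->
  exists (u : 'cV_n) (v : 'rV_m) (x : 'cV_k) (y : 'rV_l),
    [/\ N *m x = P *m u, y *m L = v *m P & v *m P *m u = 1%:M].
Proof.
move=> /exists_pairing_1[y [x yx]].
set y' := y *m coker_proj (L *m ker_proj P).
set x' := ker_proj (coker_proj P *m N) *m x.
have Nx : N *m x' = P *m (ginv P *m N *m x').
  have /eqP : coker_proj P *m N *m x' = 0.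
    by rewrite /x' mulmxA mul_ker_proj mul0mx.
  by rewrite [_ *m N]mulmxBl mul1mx mulmxBl subr_eq0 => /eqP ->; rewrite !mulmxA.
have yL : y' *m L = y' *m L *m ginv P *m P.
  have /eqP : y' *m (L *m ker_proj P) = 0.
    by rewrite /y' -mulmxA mul_coker_proj mulmx0.
  by rewrite [L *m _]mulmxBr mulmx1 mulmxBr subr_eq0 => /eqP E; rewrite {1}E !mulmxA.
exists (ginv P *m N *m x'), (y' *m L *m ginv P), x', y'; split=> //.
by rewrite -yL -yx /residual_pairing /x' /y' !mulmxA.
Qed.

Lemma col_outside {m n k} (P : 'M[K]_(m, n)) (N : 'M[K]_(m, k)) :
  (qrank P < qrank (row_mx P N))%N ->
  exists (u : 'rV_m) (x : 'cV_k), u *m P = 0 /\ u *m (N *m x) = 1%:M.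
Proof.
rewrite qrank_row_coker -{1}[qrank P]addn0 ltn_add2l => Q0.
have [|u [x ux]] := exists_pairing_1 (coker_proj P *m N).
  by apply: contraTneq Q0 => ->; rewrite qrank0.
exists (u *m coker_proj P), x; rewrite -mulmxA mul_coker_proj mulmx0.
by rewrite -ux !mulmxA.
Qed.

Lemma row_outside {m n l} (P : 'M[K]_(m, n)) (L : 'M[K]_(l, n)) :
  (qrank P < qrank (col_mx P L))%N ->
  exists (v : 'cV_n) (y : 'rV_l), P *m v = 0 /\ y *m L *m v = 1%:M.
Proof.
rewrite qrank_col_ker -{1}[qrank P]addn0 ltn_add2l => Q0.
have [|y [v yv]] := exists_pairing_1 (L *m ker_proj P).
  by apply: contraTneq Q0 => ->; rewrite qrank0.
exists (ker_proj P *m v), y; rewrite mulmxA mul_ker_proj mul0mx.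
by rewrite -yv !mulmxA.
Qed.

(** * Sums of products that lower or raise the rank *)

(** Here [v P] is split into two rows, each multiplied by its own column. Let [Q = P - P u v P];
    since [v P (u - u') = 0], the matrix is [Q (1 + (u - u') w)], of rank at most that of [Q]. *)
Lemma qrank_deflate_cols {m n} {P : 'M[K]_(m, n)} {u u' : 'cV_n} {v : 'rV_m}
    (w : 'rV_n) :
  v *m P *m u = 1%:M -> v *m P *m u' = 1%:M ->
  (qrank (P - P *m u *m (v *m P - w) - P *m u' *m w) < qrank P)%N.
Proof.
move=> vPu vPu'; apply: leq_ltn_trans (qrank_deflate vPu).
have -> : P - P *m u *m (v *m P - w) - P *m u' *m w
          = (P - P *m u *m v *m P) *m (1%:M + (u - u') *m w).
  have E : P *m u *m v *m P *m (u - u') = 0.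
    by rewrite -!(mulmxA (P *m u)) mulmxBr vPu vPu' subrr mulmx0.
  rewrite [RHS]mulmxDr mulmx1 mulmxA [(P - _) *m (u - u')]mulmxBl E subr0.
  rewrite !mulmxBr mulmxBl opprB !mulmxA.
  by rewrite !addrA; congr (_ - _); rewrite addrAC.
exact: qrank_mulmxr.
Qed.

Lemma qrank_deflate_rows {m n} {P : 'M[K]_(m, n)} {u : 'cV_n} {v v' : 'rV_m}
    (w : 'cV_m) :
  v *m P *m u = 1%:M -> v' *m P *m u = 1%:M ->
  (qrank (P - (P *m u - w) *m (v *m P) - w *m (v' *m P)) < qrank P)%N.
Proof.
move=> vPu vPu'; apply: leq_ltn_trans (qrank_deflate vPu).
have -> : P - (P *m u - w) *m (v *m P) - w *m (v' *m P)
          = (1%:M + w *m (v - v')) *m (P - P *m u *m v *m P).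
  have E : (v - v') *m (P *m u *m v *m P) = 0.
    by rewrite !mulmxA !mulmxBl vPu vPu' subrr.
  rewrite [RHS]mulmxDl mul1mx -[w *m _ *m _]mulmxA [_ *m (P - _)]mulmxBr E subr0.
  rewrite !mulmxBl mulmxBr opprB !mulmxA.
  by rewrite !addrA; congr (_ - _); rewrite addrAC.
exact: qrank_mulmxl.
Qed.

(* The new matrix is [P] deflated twice, at [(u' - u, v')] and then at [(u, v)],
   plus the rank-one term [(P u' - P u - b) (v' P - v P + d)]. *)
Lemma qrank_deflate_cross {m n} {P : 'M[K]_(m, n)} {u u' : 'cV_n} {v v' : 'rV_m}
    (b : 'cV_m) (d : 'rV_n) :
  v *m P *m u = 1%:M -> v *m P *m u' = 1%:M ->
  v' *m P *m u = 0 -> v' *m P *m u' = 1%:M ->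
  (qrank (P - P *m u *m d - b *m (v' *m P)
          - (P *m u' - b) *m (v *m P - d)) < qrank P)%N.
Proof.
move=> vu vu' v'u v'u'.
have v's : v' *m P *m (u' - u) = 1%:M by rewrite mulmxBr v'u v'u' subr0.
set P1 := P - P *m (u' - u) *m v' *m P.
have P1u : P1 *m u = P *m u.
  by rewrite mulmxBl -!(mulmxA (P *m (u' - u))) v'u mulmx0 subr0.
have vP1 : v *m P1 = v *m P.
  by rewrite mulmxBr !mulmxA mulmxBr vu vu' subrr !mul0mx subr0.
have vP1u : v *m P1 *m u = 1%:M by rewrite vP1.
have -> : P - P *m u *m d - b *m (v' *m P) - (P *m u' - b) *m (v *m P - d)
    = (P1 - P1 *m u *m v *m P1) + (P *m u' - P *m u - b) *m (v' *m P - v *m P + d).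
  rewrite P1u -(mulmxA _ v) vP1 /P1 -(mulmxA _ v') [P *m (_ - _)]mulmxBr.
  move: (P *m u) (P *m u') (v *m P) (v' *m P) => p p' q q'.
  have -> : (p' - p - b) *m (q' - q + d)
      = (p' - p) *m q' - b *m q' + (p *m q - p *m d - (p' - b) *m (q - d)).
    have -> : q' - q + d = q' - (q - d) by rewrite opprB addrA addrAC.
    rewrite mulmxBr mulmxBl; congr (_ + _).
    by rewrite addrAC (mulmxBl _ p) opprB [p *m (q - d)]mulmxBr.
  rewrite -!addrA; congr (P + _).
  rewrite (addrCA _ (_ *m q')) addKr (addrCA (- (b *m q'))).
  by rewrite addKr addrCA.
apply: leq_ltn_trans (qrankD _ _) _.
apply: leq_ltn_trans (leq_add (leqnn _) (qrank_le_inner _ _)) _.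
rewrite addn1; exact: leq_ltn_trans (qrank_deflate vP1u) (qrank_deflate v's).
Qed.

(** Deflation read backwards: [P + b d] deflated at [(v, u)] is [P]. *)
Lemma qrank_inflate {m n} {P : 'M[K]_(m, n)} {b : 'cV_m} {d : 'rV_n}
    {u : 'rV_m} {v : 'cV_n} :
  u *m P = 0 -> u *m b = 1%:M -> P *m v = 0 -> d *m v = 1%:M ->
  (qrank P < qrank (P + b *m d))%N.
Proof.
move=> uP ub Pv dv.
have uP1 : u *m (P + b *m d) = d by rewrite mulmxDr uP mulmxA ub mul1mx add0r.
have P1v : (P + b *m d) *m v = b by rewrite mulmxDl Pv -mulmxA dv mulmx1 add0r.
have := qrank_deflate (P := P + b *m d) (u := v) (v := u).
by rewrite P1v -(mulmxA b) uP1 addrK; apply.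
Qed.

(* Adding [b (d P) + (P c) e] has the same effect on the rank as bordering [P]
   with the column [P c] and the row [d P]. *)
Lemma qrank_inflate_cross {m n} {P : 'M[K]_(m, n)} {b : 'cV_m} {e : 'rV_n}
    {c : 'cV_n} {d : 'rV_m} {u : 'rV_m} {v : 'cV_n} :
  u *m P = 0 -> u *m b = 1%:M -> P *m v = 0 -> e *m v = 1%:M ->
  d *m P *m c = 1%:M ->
  (qrank P < qrank (P + b *m (d *m P) + P *m c *m e))%N.
Proof.
move=> uP ub Pv ev dPc; set P1 := P + _ + _.
(* [w] and [z] solve [w P1 = - e] and [P1 z = b], and [e v = 1] yields [w P1 z = 1]. Deflating [P1]
   there gives [P1 + b e], from which [P] is recovered by multiplication on both sides. *)
pose w := u - d + d *m b *m u.
pose z := c - v *m e *m c - v.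
have uP1 : u *m P1 = d *m P.
  by rewrite /P1 !mulmxDr !mulmxA ub uP !mul0mx addr0 add0r mul1mx.
have dP1 : d *m P1 = d *m P + d *m b *m (d *m P) + e.
  by rewrite /P1 !mulmxDr !mulmxA dPc mul1mx.
have wP1 : w *m P1 = - e.
  rewrite mulmxDl mulmxBl -(mulmxA _ u) uP1 dP1.
  by rewrite -[_ + _ + e]addrA opprD addNKr opprD addrAC addNr add0r.
have P1v : P1 *m v = P *m c.
  by rewrite /P1 !mulmxDl -!mulmxA ev Pv !mulmx0 mulmx1 !add0r.
have P1c : P1 *m c = P *m c + b + P *m c *m (e *m c).
  by rewrite /P1 !mulmxDl -!mulmxA (mulmxA d) dPc mulmx1.
have P1z : P1 *m z = b.
  rewrite !mulmxBr !mulmxA P1v P1c -!mulmxA.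
  by rewrite addrK addrAC subrr add0r.
have wP1z : w *m P1 *m z = 1%:M.
  by rewrite wP1 mulNmx !mulmxBr !mulmxA ev mul1mx subrr sub0r opprK.
apply: leq_ltn_trans (qrank_deflate wP1z).
have -> : P1 - P1 *m z *m w *m P1 = P1 + b *m e.
  by rewrite P1z -mulmxA wP1 mulmxN opprK.
have PE : P = (1%:M - b *m u) *m (P1 + b *m e) *m (1%:M - v *m e).
  have -> : (1%:M - b *m u) *m (P1 + b *m e) = P + P *m c *m e.
    rewrite mulmxBl mul1mx -(mulmxA b) (mulmxDr u) uP1 (mulmxA u) ub mul1mx.
    by rewrite mulmxDr [_ + b *m e]addrC addrKA /P1 addrAC addrK.
  rewrite mulmxBr mulmx1 mulmxA mulmxDl -(mulmxA (P *m c)) ev Pv mulmx1 add0r.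
  by rewrite addrK.
by rewrite {1}PE; apply: leq_trans (qrank_mulmxr _ _) (qrank_mulmxl _ _).
Qed.

(** * Linked rows and columns, and the pencil *)

(** The conclusion of [residual_pairing_witness]: the pairing between the parts of [L] and [N] lying
    in the row and column space of [P] is nonzero, normalised to 1. *)
Definition linked {m n k l} (P : 'M[K]_(m, n)) (L : 'M[K]_(l, n))
    (N : 'M[K]_(m, k)) : Prop :=
  exists (u : 'cV_n) (v : 'rV_m) (x : 'cV_k) (y : 'rV_l),
    [/\ N *m x = P *m u, y *m L = v *m P & v *m P *m u = 1%:M].

Lemma linked_col_mxC {m n k l l'} {P : 'M[K]_(m, n)} {L : 'M[K]_(l, n)}
    {L' : 'M[K]_(l', n)} {N : 'M[K]_(m, k)} :
  linked P (col_mx L L') N -> linked P (col_mx L' L) N.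
Proof.
move=> [u [v [x [y [Nx yL vPu]]]]].
exists u, v, x, (row_mx (rsubmx y) (lsubmx y)); split=> //.
by rewrite -yL -[y in RHS]hsubmxK !mul_row_col addrC.
Qed.

Lemma linked_row_mxC {m n k k' l} {P : 'M[K]_(m, n)} {L : 'M[K]_(l, n)}
    {N : 'M[K]_(m, k)} {N' : 'M[K]_(m, k')} :
  linked P L (row_mx N N') -> linked P L (row_mx N' N).
Proof.
move=> [u [v [x [y [Nx yL vPu]]]]].
exists u, v, (col_mx (dsubmx x) (usubmx x)), y; split=> //.
by rewrite -Nx -[x in RHS]vsubmxK !mul_row_col addrC.
Qed.

(** When neither [N] nor [L] alone raises the rank, only the pairing term of [qrank_block_mx] can do
    so. *)
Lemma linked_of_rank {m n k l} {P : 'M[K]_(m, n)} {L : 'M[K]_(l, n)}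
    {N : 'M[K]_(m, k)} :
  (qrank (row_mx P N) <= qrank P)%N -> (qrank (col_mx P L) <= qrank P)%N ->
  (qrank P < qrank (block_mx P N L 0))%N -> linked P L N.
Proof.
move=> PN PL; have := qrank_block_mx P L N; have := qrank_col_ker P L.
have [E|/residual_pairing_witness//] := eqVneq (residual_pairing P L N) 0.
rewrite E qrank0; lia.
Qed.

(** Used to find one row (or column) pairing nontrivially with two given columns (or rows): one of
    two candidates, or their sum. *)
Lemma pair_nonzero (V : zmodType) (a b c d : V) : a != 0 -> d != 0 ->
  [\/ a != 0 /\ b != 0, c != 0 /\ d != 0 | a + c != 0 /\ b + d != 0].
Proof.
move=> a0 d0; have [->|b0] := eqVneq b 0; last by constructor 1.
have [->|c0] := eqVneq c 0; last by constructor 2.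
by constructor 3; rewrite addr0 add0r.
Qed.

Definition pencil {m n p1 p2 q1 q2 : nat} (P : 'M[K]_(m, n))
    (B : 'M[K]_(m, p1)) (C : 'M[K]_(m, p2)) (D : 'M[K]_(q1, n))
    (E : 'M[K]_(q2, n)) (X : 'M[K]_(p1, q1)) (Y : 'M[K]_(p2, q2)) :
    'M[K]_(m, n) := P - B *m X *m D - C *m Y *m E.

Lemma pencilC {m n p1 p2 q1 q2 : nat} (P : 'M[K]_(m, n)) (B : 'M[K]_(m, p1))
    (C : 'M[K]_(m, p2)) (D : 'M[K]_(q1, n)) (E : 'M[K]_(q2, n)) X Y :
  pencil P B C D E X Y = pencil P C B E D Y X.
Proof. by rewrite /pencil addrAC. Qed.

Lemma pencil_pencil {m n p1 p2 q1 q2 : nat} (P : 'M[K]_(m, n))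
    (B : 'M[K]_(m, p1)) (C : 'M[K]_(m, p2)) (D : 'M[K]_(q1, n))
    (E : 'M[K]_(q2, n)) X Y X' Y' :
  pencil (pencil P B C D E X Y) B C D E X' Y' = pencil P B C D E (X + X') (Y + Y').
Proof.
rewrite /pencil (mulmxDr B) (mulmxDr C) (mulmxDl _ _ D) (mulmxDl _ _ E).
rewrite !opprD -!addrA; congr (P + (_ + _)).
by rewrite (addrCA (- (C *m Y *m E))).
Qed.

Lemma pencil_rank1 {m n p1 p2 q1 q2 : nat} (P : 'M[K]_(m, n))
    (B : 'M[K]_(m, p1)) (C : 'M[K]_(m, p2)) (D : 'M[K]_(q1, n))
    (E : 'M[K]_(q2, n)) (x : 'cV_p1) (y : 'rV_q1) (x' : 'cV_p2) (y' : 'rV_q2) :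
  pencil P B C D E (x *m y) (x' *m y')
  = P - B *m x *m (y *m D) - C *m x' *m (y' *m E).
Proof. by rewrite /pencil !mulmxA. Qed.

(** * Lowering the rank along the pencil *)

Section Moves.
Context {m n p1 p2 q1 q2 : nat} {P : 'M[K]_(m, n)}.
Context {B : 'M[K]_(m, p1)} {C : 'M[K]_(m, p2)}.
Context {D : 'M[K]_(q1, n)} {E : 'M[K]_(q2, n)}.

Lemma scalar1_neq0 : (1%:M : 'M[K]_1) != 0.
Proof. by apply/eqP => /matrixP/(_ 0 0)/eqP; rewrite !mxE oner_eq0. Qed.

(** By [pair_nonzero] a single [v1] pairs with both [u] and [u'], which are then rescaled. The row
    [v1 P] is a combination of rows of [D] plus one of rows of [E]; the first is multiplied by a
    column from [B], the second by one from [C]. *)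
Lemma pencil_decrease_cols : linked P (col_mx D E) B -> linked P (col_mx D E) C ->
  exists X Y, (qrank (pencil P B C D E X Y) < qrank P)%N.
Proof.
move=> [u [v [x [y [Bx yL vPu]]]]] [u' [v' [x' [y' [Cx yL' vPu']]]]].
suff main (v1 : 'rV_m) (y1 : 'rV_(q1 + q2)) : y1 *m col_mx D E = v1 *m P ->
    v1 *m P *m u != 0 -> v1 *m P *m u' != 0 ->
    exists X Y, (qrank (pencil P B C D E X Y) < qrank P)%N.
  have v0 : v *m P *m u != 0 by rewrite vPu scalar1_neq0.
  have v0' : v' *m P *m u' != 0 by rewrite vPu' scalar1_neq0.
  have [] := @pair_nonzero _ _ (v *m P *m u') (v' *m P *m u) _ v0 v0'.
  - by case; apply: main yL.
  - by case; apply: main yL'.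
  - case; rewrite -!mulmxDl; apply: (main _ (y + y') _).
    by rewrite !mulmxDl yL yL'.
rewrite -[y1]hsubmxK mul_row_col => yv /scale_to_1[a ua _] /scale_to_1[a' ua' _].
exists (x *m a *m lsubmx y1), (x' *m a' *m rsubmx y1).
rewrite pencil_rank1 !mulmxA Bx Cx -(mulmxA P u) -(mulmxA P u').
rewrite -(mulmxA _ _ D) -(mulmxA _ _ E).
have -> : lsubmx y1 *m D = v1 *m P - rsubmx y1 *m E by rewrite -yv addrK.
by apply: (qrank_deflate_cols (u := u *m a) (u' := u' *m a')); rewrite mulmxA.
Qed.

(** Mirror image of [pencil_decrease_cols]. Plain transposition does not preserve quaternion rank,
    so the argument is repeated with scalars acting on the left of the rows. *)
Lemma pencil_decrease_rows : linked P D (row_mx B C) -> linked P E (row_mx B C) ->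
  exists X Y, (qrank (pencil P B C D E X Y) < qrank P)%N.
Proof.
move=> [u [v [x [y [Nx yD vPu]]]]] [u' [v' [x' [y' [Nx' yE vPu']]]]].
suff main (u1 : 'cV_n) (x1 : 'cV_(p1 + p2)) : row_mx B C *m x1 = P *m u1 ->
    v *m P *m u1 != 0 -> v' *m P *m u1 != 0 ->
    exists X Y, (qrank (pencil P B C D E X Y) < qrank P)%N.
  have v0 : v *m P *m u != 0 by rewrite vPu scalar1_neq0.
  have v0' : v' *m P *m u' != 0 by rewrite vPu' scalar1_neq0.
  have [] := @pair_nonzero _ _ (v' *m P *m u) (v *m P *m u') _ v0 v0'.
  - by case; apply: main Nx.
  - by case; apply: main Nx'.
  - case; rewrite -!mulmxDr; apply: (main _ (x + x') _).
    by rewrite !mulmxDr Nx Nx'.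
rewrite -[x1]vsubmxK mul_row_col => xu.
move=> /scale_to_1[a _ ua] /scale_to_1[a' _ ua'].
exists (usubmx x1 *m (a *m y)), (dsubmx x1 *m (a' *m y')).
rewrite pencil_rank1 -(mulmxA a) -(mulmxA a') yD yE (mulmxA a) (mulmxA a').
have -> : B *m usubmx x1 = P *m u1 - C *m dsubmx x1 by rewrite -xu addrK.
by apply: (qrank_deflate_rows (v := a *m v) (v' := a' *m v'));
  rewrite -2!mulmxA (mulmxA v, mulmxA v').
Qed.

Lemma pencil_decrease_single : linked P D B ->
  exists X Y, (qrank (pencil P B C D E X Y) < qrank P)%N.
Proof.
move=> [u [v [x [y [Bx yD vPu]]]]]; exists (x *m y), 0.
rewrite /pencil mulmx0 mul0mx subr0 mulmxA Bx -(mulmxA _ y) yD mulmxA.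
exact: qrank_deflate.
Qed.

(** If [v' P u] is nonzero, [B] and [D] are themselves linked and one product suffices. Otherwise
    [qrank_deflate_cross] applies: two of its products pair [B] with [D] and go into [X], the third
    pairs [C] with [E] and gives [Y]. *)
Lemma pencil_decrease_cross : linked P (col_mx D E) B -> linked P D (row_mx B C) ->
  exists X Y, (qrank (pencil P B C D E X Y) < qrank P)%N.
Proof.
move=> [u [v [x [y [Bx yL vu]]]]] [u' [v' [x' [y' [Nx' yD v'u']]]]].
have [v'u|v'u] := eqVneq (v' *m P *m u) 0; last first.
  have [a ua _] := scale_to_1 _ v'u; apply: pencil_decrease_single.
  by exists (u *m a), v', (x *m a), y'; rewrite !mulmxA Bx ua.
(* Shifting [u'] along [u] normalises [v P u'] without changing [v' P u']. *)
pose t : 'M[K]_1 := 1%:M - v *m P *m u'.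
have vw : v *m P *m (u' + u *m t) = 1%:M.
  by rewrite mulmxDr mulmxA vu mul1mx addrC subrK.
have v'w : v' *m P *m (u' + u *m t) = 1%:M.
  by rewrite mulmxDr mulmxA v'u mul0mx addr0.
move: Nx' yL; rewrite -[x']vsubmxK -[y]hsubmxK !mul_row_col.
set b := B *m usubmx x'; set d := lsubmx y *m D => Nx' yL.
exists (x *m lsubmx y + (usubmx x' + x *m t) *m y'), (dsubmx x' *m rsubmx y).
have := qrank_deflate_cross (b + P *m u *m t) d vu vw v'u v'w.
have -> : P *m (u' + u *m t) - (b + P *m u *m t) = C *m dsubmx x'.
  by rewrite mulmxDr mulmxA [b + _]addrC addrKA -Nx' addrAC subrr add0r.
have -> : v *m P - d = rsubmx y *m E by rewrite -yL addrAC subrr add0r.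
have BXD : B *m (x *m lsubmx y + (usubmx x' + x *m t) *m y') *m D
           = P *m u *m d + (b + P *m u *m t) *m (v' *m P).
  rewrite mulmxDr mulmxDl (mulmxA B x) Bx -(mulmxA (P *m u)) (mulmxA B _ y').
  by rewrite -(mulmxA _ y') yD (mulmxDr B) (mulmxA B x) Bx.
by rewrite /pencil BXD opprD addrA !mulmxA.
Qed.

End Moves.

(** * Raising the rank along the pencil *)

Lemma pencil_increase_single {m n p1 p2 q1 q2} {P : 'M[K]_(m, n)} {B : 'M[K]_(m, p1)}
    (C : 'M[K]_(m, p2)) {D : 'M[K]_(q1, n)} (E : 'M[K]_(q2, n)) :
  (qrank P < qrank (row_mx P B))%N -> (qrank P < qrank (col_mx P D))%N ->
  exists X Y, (qrank P < qrank (pencil P B C D E X Y))%N.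
Proof.
move=> /col_outside[u [x [uP uBx]]] /row_outside[v [y [Pv yDv]]].
exists (- x *m y), 0; rewrite /pencil mulmx0 mul0mx subr0 mulmxA mulmxN !mulNmx.
rewrite opprK -mulmxA; exact: qrank_inflate uP uBx Pv yDv.
Qed.

Lemma pencil_increase_cross {m n p1 p2 q1 q2} {P : 'M[K]_(m, n)} {B : 'M[K]_(m, p1)}
    {C : 'M[K]_(m, p2)} {D : 'M[K]_(q1, n)} {E : 'M[K]_(q2, n)} :
  (qrank P < qrank (row_mx P B))%N -> (qrank P < qrank (col_mx P E))%N ->
  linked P D C -> exists X Y, (qrank P < qrank (pencil P B C D E X Y))%N.
Proof.
move=> /col_outside[u [x [uP uBx]]] /row_outside[v [y [Pv yEv]]].
move=> [c [d [x' [y' [Cx' y'D dPc]]]]].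
exists (- x *m y'), (- x' *m y); rewrite pencil_rank1 !mulmxN !mulNmx !opprK.
rewrite Cx' y'D; exact: qrank_inflate_cross uP uBx Pv yEv dPc.
Qed.

Lemma qrank_row_mx_or {m n k k'} {P : 'M[K]_(m, n)} {N : 'M[K]_(m, k)}
    {N' : 'M[K]_(m, k')} : (qrank P < qrank (row_mx P (row_mx N N')))%N ->
  (qrank P < qrank (row_mx P N))%N \/ (qrank P < qrank (row_mx P N'))%N.
Proof.
rewrite !(qrank_row_coker P) mul_mx_row qrank_row_coker.
have := qrank_mulmxl (coker_proj (coker_proj P *m N)) (coker_proj P *m N'); lia.
Qed.

Lemma qrank_col_mx_or {m n l l'} {P : 'M[K]_(m, n)} {L : 'M[K]_(l, n)}
    {L' : 'M[K]_(l', n)} : (qrank P < qrank (col_mx P (col_mx L L')))%N ->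
  (qrank P < qrank (col_mx P L))%N \/ (qrank P < qrank (col_mx P L'))%N.
Proof.
rewrite !(qrank_col_ker P) mul_col_mx qrank_col_ker.
have := qrank_mulmxr (L' *m ker_proj P) (ker_proj (L *m ker_proj P)); lia.
Qed.

(** If [B] and [D], or [C] and [E], both raise the rank, one product suffices. Otherwise only [B]
    and [E] raise it, or only [C] and [D]; the hypothesis on the block matrix of the other two then
    gives the link for the crossed move. *)
Lemma pencil_increase {m n p1 p2 q1 q2} {P : 'M[K]_(m, n)} {B : 'M[K]_(m, p1)}
    {C : 'M[K]_(m, p2)} {D : 'M[K]_(q1, n)} {E : 'M[K]_(q2, n)} :
  (qrank P < qrank (col_mx P (col_mx D E)))%N ->
  (qrank P < qrank (row_mx P (row_mx B C)))%N ->
  (qrank P < qrank (block_mx P B E 0))%N ->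
  (qrank P < qrank (block_mx P C D 0))%N ->
  exists X Y, (qrank P < qrank (pencil P B C D E X Y))%N.
Proof.
move=> PDE PBC PBE PCD.
have swap : (exists Y X, (qrank P < qrank (pencil P C B E D Y X))%N) ->
    exists X Y, (qrank P < qrank (pencil P B C D E X Y))%N.
  by move=> [Y [X XY]]; exists X, Y; rewrite pencilC.
have [PB|PB] := ltnP (qrank P) (qrank (row_mx P B)).
  have [PD|PD] := ltnP (qrank P) (qrank (col_mx P D)).
    exact: pencil_increase_single.
  have [|PE] := qrank_col_mx_or PDE; first by rewrite ltnNge PD.
  have [PC|PC] := ltnP (qrank P) (qrank (row_mx P C)).
    exact/swap/pencil_increase_single.
  exact/pencil_increase_cross/linked_of_rank.
have [|PC] := qrank_row_mx_or PBC; first by rewrite ltnNge PB.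
have [PE|PE] := ltnP (qrank P) (qrank (col_mx P E)).
  exact/swap/pencil_increase_single.
have [PD|] := qrank_col_mx_or PDE; last by rewrite ltnNge PE.
exact/swap/pencil_increase_cross/linked_of_rank.
Qed.

(** * The lower bound for the minimum and when it is strict *)

(** After expansion by [qrank_block_mx], the right side exceeds the left by the pairing ranks of
    [(L', N)] and [(L, N J)] minus that of [(L', N J)]. In the application [J] selects [B] or [C]
    from [[B, C]]. *)
Lemma qrank_block_bound {m n k k' l l'} (P : 'M[K]_(m, n)) (N : 'M[K]_(m, k))
    (J : 'M[K]_(k, k')) (L : 'M[K]_(l, n)) (L' : 'M[K]_(l', n)) :
  (qrank (col_mx P L) + qrank (row_mx P N) + qrank (block_mx P (N *m J) L' 0)
   <= qrank P + qrank (block_mx P N L' 0) + qrank (block_mx P (N *m J) L 0))%N.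
Proof.
have := qrank_residual_le P L' N J.
rewrite !qrank_block_mx qrank_col_ker; lia.
Qed.

Lemma linked_of_block_bound_lt {m n k k' l l'} {P : 'M[K]_(m, n)}
    {N : 'M[K]_(m, k)} {J : 'M[K]_(k, k')} {L : 'M[K]_(l, n)} {L' : 'M[K]_(l', n)} :
  (qrank (col_mx P L) + qrank (row_mx P N) + qrank (block_mx P (N *m J) L' 0)
   < qrank P + qrank (block_mx P N L' 0) + qrank (block_mx P (N *m J) L 0))%N ->
  linked P L (N *m J) \/ linked P L' N.
Proof.
rewrite !qrank_block_mx qrank_col_ker.
have [->|/residual_pairing_witness] := eqVneq (residual_pairing P L (N *m J)) 0;
  last by left.
have [->|/residual_pairing_witness] := eqVneq (residual_pairing P L' N) 0;
  last by right.
rewrite !qrank0; lia.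
Qed.

Lemma pencil_decrease {m n p1 p2 q1 q2} {P : 'M[K]_(m, n)} {B : 'M[K]_(m, p1)}
    {C : 'M[K]_(m, p2)} {D : 'M[K]_(q1, n)} {E : 'M[K]_(q2, n)} :
  linked P (col_mx D E) B \/ linked P E (row_mx B C) ->
  linked P (col_mx D E) C \/ linked P D (row_mx B C) ->
  exists X Y, (qrank (pencil P B C D E X Y) < qrank P)%N.
Proof.
case=> l1 [] l2.
- exact: pencil_decrease_cols.
- exact: pencil_decrease_cross.
- have [Y [X XY]] := pencil_decrease_cross (linked_col_mxC l2) (linked_row_mxC l1).
  by exists X, Y; rewrite pencilC.
- exact: pencil_decrease_rows.
Qed.

(** * Invariance of the bordered ranks along the pencil *)

Lemma qrank_col_mx_shift {m n l} (A : 'M[K]_(m, n)) (L : 'M[K]_(l, n)) Y :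
  qrank (col_mx (A + Y *m L) L) = qrank (col_mx A L).
Proof.
have le A' Y' : (qrank (col_mx (A' + Y' *m L : 'M[K]_(m, n)) L)
                 <= qrank (col_mx A' L))%N.
  have -> : col_mx (A' + Y' *m L) L = block_mx 1%:M Y' 0 1%:M *m col_mx A' L.
    by rewrite mul_block_col !mul1mx mul0mx add0r.
  exact: qrank_mulmxl.
apply/eqP; rewrite eqn_leq le.
by have := le (A + Y *m L) (- Y); rewrite mulNmx addrK.
Qed.

Lemma qrank_row_mx_shift {m n k} (A : 'M[K]_(m, n)) (N : 'M[K]_(m, k)) X :
  qrank (row_mx (A + N *m X) N) = qrank (row_mx A N).
Proof.
have le A' X' : (qrank (row_mx (A' + N *m X' : 'M[K]_(m, n)) N)
                 <= qrank (row_mx A' N))%N.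
  have -> : row_mx (A' + N *m X') N = row_mx A' N *m block_mx 1%:M 0 X' 1%:M.
    by rewrite mul_row_block !mulmx1 mulmx0 add0r.
  exact: qrank_mulmxr.
apply/eqP; rewrite eqn_leq le.
by have := le (A + N *m X) (- X); rewrite mulmxN addrK.
Qed.

Lemma qrank_block_mx_shift {m n k l} (A : 'M[K]_(m, n)) (N : 'M[K]_(m, k))
    (L : 'M[K]_(l, n)) X Y :
  qrank (block_mx (A + N *m X + Y *m L) N L 0) = qrank (block_mx A N L 0).
Proof.
have le A' X' Y' : (qrank (block_mx (A' + N *m X' + Y' *m L : 'M[K]_(m, n)) N L 0)
                    <= qrank (block_mx A' N L 0))%N.
  have -> : block_mx (A' + N *m X' + Y' *m L) N L 0
      = block_mx 1%:M Y' 0 1%:M *m block_mx A' N L 0 *m block_mx 1%:M 0 X' 1%:M.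
    rewrite !mulmx_block !(mul1mx, mulmx1, mul0mx, mulmx0, addr0, add0r).
    by rewrite addrAC.
  exact: leq_trans (qrank_mulmxr _ _) (qrank_mulmxl _ _).
apply/eqP; rewrite eqn_leq le.
have := le (A + N *m X + Y *m L) (- X) (- Y).
by rewrite mulNmx mulmxN addrAC addrK addrK.
Qed.

Section Pencil.
Context {m n p1 p2 q1 q2 : nat} (A : 'M[K]_(m, n)).
Context (B : 'M[K]_(m, p1)) (C : 'M[K]_(m, p2)).
Context (D : 'M[K]_(q1, n)) (E : 'M[K]_(q2, n)).
Context (X : 'M[K]_(p1, q1)) (Y : 'M[K]_(p2, q2)).
Local Notation P := (pencil A B C D E X Y).

Lemma qrank_col_pencil :
  qrank (col_mx P (col_mx D E)) = qrank (col_mx A (col_mx D E)).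
Proof.
rewrite -(qrank_col_mx_shift A _ (row_mx (- (B *m X)) (- (C *m Y)))).
by rewrite mul_row_col !mulNmx addrA.
Qed.

Lemma qrank_row_pencil :
  qrank (row_mx P (row_mx B C)) = qrank (row_mx A (row_mx B C)).
Proof.
rewrite -(qrank_row_mx_shift A _ (col_mx (- (X *m D)) (- (Y *m E)))).
by rewrite mul_row_col !mulmxN !mulmxA addrA.
Qed.

Lemma qrank_block_pencil_BE :
  qrank (block_mx P B E 0) = qrank (block_mx A B E 0).
Proof.
rewrite -(qrank_block_mx_shift A _ _ (- (X *m D)) (- (C *m Y))).
by rewrite mulmxN mulNmx mulmxA.
Qed.

Lemma qrank_block_pencil_BC k (L : 'M[K]_(k, n)) :
  qrank (block_mx P (row_mx B C) L 0) = qrank (block_mx A (row_mx B C) L 0).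
Proof.
rewrite -(qrank_block_mx_shift A _ _ (col_mx (- (X *m D)) (- (Y *m E))) 0).
by rewrite mul0mx addr0 mul_row_col !mulmxN !mulmxA addrA.
Qed.

Lemma qrank_block_pencil_DE k (N : 'M[K]_(m, k)) :
  qrank (block_mx P N (col_mx D E) 0) = qrank (block_mx A N (col_mx D E) 0).
Proof.
rewrite -(qrank_block_mx_shift A _ _ 0 (row_mx (- (B *m X)) (- (C *m Y)))).
by rewrite mulmx0 addr0 mul_row_col !mulNmx addrA.
Qed.

End Pencil.

Lemma qrank_block_pencil_CD {m n p1 p2 q1 q2 : nat} (A : 'M[K]_(m, n))
    (B : 'M[K]_(m, p1)) (C : 'M[K]_(m, p2)) (D : 'M[K]_(q1, n))
    (E : 'M[K]_(q2, n)) X Y :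
  qrank (block_mx (pencil A B C D E X Y) C D 0) = qrank (block_mx A C D 0).
Proof. by rewrite pencilC qrank_block_pencil_BE. Qed.

End QuaternionRank.

(** * The two extremal ranks *)

Theorem theorem3p1 (R : realType) (m n p1 p2 q1 q2 : nat)
    (A : 'M[quat R]_(m, n)) (B : 'M[quat R]_(m, p1)) (C : 'M[quat R]_(m, p2))
    (D : 'M[quat R]_(q1, n)) (E : 'M[quat R]_(q2, n)) :
  let p (X : 'M[quat R]_(p1, q1)) (Y : 'M[quat R]_(p2, q2)) :=
    A - B *m X *m D - C *m Y *m E in
  let s1 : int :=
    (qrank (block_mx A B E 0))%:Z
    - (qrank (block_mx A (row_mx B C) E (row_mx 0 0)))%:Z
    - (qrank (block_mx A B (col_mx D E) (col_mx 0 0)))%:Z in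
  let s2 : int :=
    (qrank (block_mx A C D 0))%:Z
    - (qrank (block_mx A (row_mx B C) D (row_mx 0 0)))%:Z
    - (qrank (block_mx A C (col_mx D E) (col_mx 0 0)))%:Z in
  is_max [set r : nat | exists X Y, r = qrank (p X Y)]%classic
    (minn (qrank (col_mx A (col_mx D E)))
      (minn (qrank (row_mx A (row_mx B C)))
        (minn (qrank (block_mx A B E 0)) (qrank (block_mx A C D 0)))))
  /\
  is_min [set r : int | exists X Y, r = (qrank (p X Y))%:Z]%classic
    ((qrank (col_mx A (col_mx D E)))%:Z + (qrank (row_mx A (row_mx B C)))%:Z
      + Num.max s1 s2).
Proof.
move=> p0 s1 s2; rewrite {}/s1 {}/s2 !row_mx0 !col_mx0.
rewrite -[p0]/(pencil A B C D E) {p0}; set p := pencil A B C D E.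
have step X Y X' Y' : pencil (p X Y) B C D E X' Y' = p (X + X') (Y + Y').
  exact: pencil_pencil.
pose Pr k := `[< exists X Y, k = qrank (p X Y) >].
have Pr0 : exists k, Pr k by exists (qrank (p 0 0)); apply/asboolP; exists 0, 0.
split.
  set b := minn _ _.
  (* Once [A] is replaced by [p X Y], each of the four matrices has [p X Y] as a block. *)
  have ub X Y : (qrank (p X Y) <= b)%N.
    rewrite /b -(qrank_col_pencil A B C D E X Y) -(qrank_row_pencil A B C D E X Y).
    rewrite -(qrank_block_pencil_BE A B C D E X Y).
    rewrite -(qrank_block_pencil_CD A B C D E X Y).
    rewrite !leq_min !qrank_block_mx qrank_col_ker !qrank_row_coker.
    by rewrite -!addnA !leq_addr.
  split; last by move=> _ [X [Y ->]]; exact: ub.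
  have Prb k : Pr k -> (k <= b)%N by move=> /asboolP[X [Y ->]].
  case: (ex_maxnP Pr0 Prb) => _ /asboolP[X [Y ->]] max.
  exists X, Y; apply/eqP; rewrite eqn_leq ub andbT leqNgt; apply/negP.
  rewrite /b -(qrank_col_pencil A B C D E X Y) -(qrank_row_pencil A B C D E X Y).
  rewrite -(qrank_block_pencil_BE A B C D E X Y).
  rewrite -(qrank_block_pencil_CD A B C D E X Y).
  rewrite !leq_min => /and4P[PDE PBC PBE PCD].
  have [X' [Y']] := pencil_increase PDE PBC PBE PCD.
  rewrite step ltnNge max //.
  by apply/asboolP; exists (X + X'), (Y + Y').
set b := _ + _.
(* [B] and [C] in the form [N J], as the block bound requires. *)
have BE : B = row_mx B C *m col_mx 1%:M 0.
  by rewrite mul_row_col mulmx1 mulmx0 addr0.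
have CE : C = row_mx B C *m col_mx 0 1%:M.
  by rewrite mul_row_col mulmx1 mulmx0 add0r.
have bE X Y : b = (qrank (col_mx (p X Y) (col_mx D E)))%:Z
    + (qrank (row_mx (p X Y) (row_mx B C)))%:Z + Num.max
   ((qrank (block_mx (p X Y) B E 0))%:Z
    - (qrank (block_mx (p X Y) (row_mx B C) E 0))%:Z
    - (qrank (block_mx (p X Y) B (col_mx D E) 0))%:Z)
   ((qrank (block_mx (p X Y) C D 0))%:Z
    - (qrank (block_mx (p X Y) (row_mx B C) D 0))%:Z
    - (qrank (block_mx (p X Y) C (col_mx D E) 0))%:Z).
  rewrite (qrank_col_pencil A B C D E) (qrank_row_pencil A B C D E).
  rewrite (qrank_block_pencil_BE A B C D E) (qrank_block_pencil_CD A B C D E).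
  rewrite (qrank_block_pencil_BC A B C D E X Y _ E).
  rewrite (qrank_block_pencil_BC A B C D E X Y _ D).
  rewrite (qrank_block_pencil_DE A B C D E X Y _ B).
  by rewrite (qrank_block_pencil_DE A B C D E X Y _ C).
have lb X Y : b <= (qrank (p X Y))%:Z.
  rewrite (bE X Y).
  have := qrank_block_bound (p X Y) (row_mx B C) (col_mx 1%:M 0) (col_mx D E) E.
  have := qrank_block_bound (p X Y) (row_mx B C) (col_mx 0 1%:M) (col_mx D E) D.
  rewrite -BE -CE; lia.
split; last by move=> _ [X [Y ->]]; exact: lb.
case: (ex_minnP Pr0) => _ /asboolP[X [Y ->]] min.
exists X, Y; apply/eqP; rewrite eq_le lb leNgt; apply/negP.
rewrite (bE X Y) => lt_b.
(* Since [b] involves the maximum of [s1] and [s2], a minimal rank above [b] makes both block bounds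
   strict: [s1] yields [l1] and [s2] yields [l2]. *)
have l1 : linked (p X Y) (col_mx D E) B \/ linked (p X Y) E (row_mx B C).
  rewrite {1}BE; apply: linked_of_block_bound_lt; rewrite -BE; lia.
have l2 : linked (p X Y) (col_mx D E) C \/ linked (p X Y) D (row_mx B C).
  rewrite {1}CE; apply: linked_of_block_bound_lt; rewrite -CE; lia.
have [X' [Y']] := pencil_decrease l1 l2.
rewrite step ltnNge min //.
by apply/asboolP; exists (X + X'), (Y + Y').
Qed.
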